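(* Let $F$ be a field and let $L$ be a Lie algebra over $F$ whose dimension over $F$ is at most countable, with $\dim(L/Z(L)) = 4$. Let $x \in L'$. Then $x \in [L,L]$ if and only if there exists a presentation $D$ of $x$ such that the corresponding weighted graph $\Gamma$ is defectless.
   Context: Lie algebra notation: $[L,L] := \{[x,y] : x,y\in L\}$ is the set of commutators (not its span); $L'$ is its $F$-linear span; $Z(L)$ is the center of $L$. Weighted graphs: a weighted graph over $F$ is a finite simple graph $\Gamma=(V,E)$ with ordered vertex set $V=\{v_1,\dots,v_n\}$, where each edge $e_{i,j}$ ($i<j$) joining $v_i$ and $v_j$ carries a weight $d_{i,j}\in F$ (possibly $0$). For an edge between $v_i$ and $v_j$ with $i<j$ put $d(v_i,v_j):=d_{i,j}$ and $d(v_j,v_i):=-d_{i,j}$. Defects of a weighted graph: - type $(4)_A$: there are distinct vertices $p_1,p_2,p_3,p_4$ such that $p_1p_2,p_1p_3,p_2p_3,p_3p_4$ are edges, $d(p_1,p_3)=d(p_2,p_3)=0$, $d(p_1,p_2)\neq0$ and $d(p_3,p_4)\ne 0$. - type $(4)_B$: there are distinct vertices $p_1,p_2,p_3,p_4$ such that $p_1p_2,p_1p_3,p_1p_4,p_2p_3,p_3p_4$ are edges, $d(p_1,p_3)=0$, the weights $d(p_1,p_2),d(p_1,p_4),d(p_2,p_3),d(p_3,p_4)$ are all nonzero, and $d(p_1,p_2)d(p_3,p_4)\neq -d(p_1,p_4)d(p_2,p_3)$. - type $(4)_C$: there are distinct vertices $p_1,p_2,p_3,p_4$, all six pairs of which are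 edges with nonzero weights, and $d(p_1,p_2)d(p_3,p_4)+d(p_1,p_4)d(p_2,p_3)\neq d(p_1,p_3)d(p_2,p_4)$. Other edges of $\Gamma$ may be present in addition to the listed ones. The graph (which here has at most four vertices) is defectless if it has no defect of type $(4)_A$, $(4)_B$ or $(4)_C$; in particular a graph with fewer than four vertices is defectless. Presentations: let $\mathcal B_1$ be a basis of $Z(L)$, extended to a basis $\mathcal B_1\cup\mathcal B_2$ of $L$, with $\mathcal B_2=\{u_1,u_2,\dots\}$. Write $x=\sum_{1\le i<j\le r} d_{i,j}[u_i,u_j]$ with $d_{i,j}\in F$ (neither $\mathcal B_2$ nor the scalars are unique). Let $\mathcal I$ be the set of all indices $k$ such that $d_{k,j}\neq 0$ for some $j$ or $d_{i,k}\ne0$ for some $i$, and let $n=|\mathcal I|$. Permute the indices so that $\mathcal I=\{1,\dots,n\}$ (with the convention $d_{j,i}=-d_{i,j}$). The corresponding weighted graph $\Gamma$ has vertices $v_1,\dots,v_n$; $v_i$ and $v_j$ are adjacent if and only if $[u_i,u_j]\neq0$, and the edge $e_{i,j}$ ($i<j$) has weight $d_{i,j}$. The weight sequence $D=(d_{i,j})_{e_{i,j}\in E}$ so obtained (for any choice of $\mathcal B_2$, of scalars, and of permutation) is called a presentation of $x$, and $\Gamma$ is its corresponding weighted graph. *)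

(* Defs.v *)
From HB Require Import structures.
From mathcomp Require Import all_boot all_algebra.
From mathcomp Require Import boolp classical_sets functions cardinality.
Set Implicit Arguments.
Unset Strict Implicit.
Unset Printing Implicit Defensive.
Import GRing.Theory.
Local Open Scope ring_scope.
Local Open Scope quotient_scope.
Local Open Scope classical_set_scope.
Local Open Scope card_scope.

(* Linear algebra in a vector space of arbitrary dimension: the library's     *)
(* bases (vectType) only cover finite dimension.                              *)

Section Bases.
Variables (F : fieldType) (V : lmodType F).

Definition linspan (B : set V) : set V :=
  [set v | exists s : seq V, exists c : V -> F,
     {in s, forall b, B b} /\ v = \sum_(b <- s) c b *: b].

Definition lin_indep (B : set V) : Prop :=
  forall (s : seq V) (c : V -> F), uniq s -> {in s, forall b, B b} ->
    \sum_(b <- s) c b *: b = 0 -> {in s, forall b, c b = 0}.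

Definition basis_of_subspace (W B : set V) : Prop :=
  lin_indep B /\ linspan B = W.

Definition has_dim (n : nat) : Prop :=
  exists B : set V, basis_of_subspace setT B /\ B #= `I_n.

Definition has_countable_dim : Prop :=
  exists B : set V, basis_of_subspace setT B /\ countable B.

End Bases.

Arguments has_dim {F} V n.
Arguments has_countable_dim {F} V.

(* The library only provides the additive quotient Quotient.quot by a         *)
(* zmodClosed predicate; it is given here the F-linear structure for which    *)
(* the projection is linear. zmod_of W is W seen as an additive subgroup.     *)

Section QuotientSpace.
Variables (F : fieldType) (V : lmodType F) (W : submodClosed V).

Definition zmod_of : {pred V} := fun v => v \in W.

Lemma zmod_of_closed : zmod_closed zmod_of.
Proof.
split=> [|u v uW vW]; first exact: rpred0.
by rewrite -scaleN1r; apply: rpredD => //; apply: rpredZ.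
Qed.

HB.instance Definition _ := GRing.isZmodClosed.Build V zmod_of zmod_of_closed.

Definition quotient_space : Type := Quotient.quot zmod_of.

HB.instance Definition _ := GRing.Zmodule.on quotient_space.

Definition quotient_proj (v : V) : quotient_space :=
  \pi_(Quotient.quot zmod_of) v.

Definition quotient_repr (q : quotient_space) : V :=
  repr (q : Quotient.quot zmod_of).

Lemma quotient_reprK : cancel quotient_repr quotient_proj.
Proof. by move=> q; apply: reprK. Qed.

Lemma quotient_proj_eq (u v : V) :
  (quotient_proj u == quotient_proj v) = (u - v \in W).
Proof. by rewrite /quotient_proj -Quotient.idealrBE. Qed.

Lemma quotient_projD : {morph quotient_proj : u v / u + v}.
Proof. by move=> u v; rewrite /quotient_proj raddfD. Qed.

Definition quotient_scale (a : F) (q : quotient_space) : quotient_space :=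
  quotient_proj (a *: quotient_repr q).

Lemma quotient_projZ a v :
  quotient_scale a (quotient_proj v) = quotient_proj (a *: v).
Proof.
apply/eqP; rewrite quotient_proj_eq -scalerBr rpredZ // -quotient_proj_eq.
by rewrite quotient_reprK.
Qed.

Lemma quotient_scaleA a b q :
  quotient_scale a (quotient_scale b q) = quotient_scale (a * b) q.
Proof. by rewrite -[q]quotient_reprK !quotient_projZ scalerA. Qed.

Lemma quotient_scale1 : left_id 1 quotient_scale.
Proof. by move=> q; rewrite -[q]quotient_reprK quotient_projZ scale1r. Qed.

Lemma quotient_scaleDr : right_distributive quotient_scale +%R.
Proof.
move=> a p q; rewrite -[p]quotient_reprK -[q]quotient_reprK -quotient_projD.
by rewrite !quotient_projZ scalerDr quotient_projD.
Qed.

Lemma quotient_scaleDl q : {morph quotient_scale^~ q : a b / a + b}.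
Proof.
move=> a b; rewrite -[q]quotient_reprK !quotient_projZ scalerDl.
by rewrite quotient_projD.
Qed.

HB.instance Definition _ := GRing.Zmodule_isLmodule.Build F quotient_space
  quotient_scaleA quotient_scale1 quotient_scaleDr quotient_scaleDl.

Lemma quotient_proj_linear : linear quotient_proj.
Proof. by move=> a u v; rewrite quotient_projD -quotient_projZ. Qed.

End QuotientSpace.

HB.mixin Record isLieAlgebra (F : fieldType) L of GRing.Lmodule F L := {
  lie : L -> L -> L;
  lie_linearl : forall y : L, linear (lie^~ y);
  lie_linearr : forall x : L, linear (lie x);
  liexx : forall x : L, lie x x = 0;
  lie_jacobi : forall x y z : L,
    lie x (lie y z) + lie y (lie z x) + lie z (lie x y) = 0
}.

#[short(type="lieAlgType")]
HB.structure Definition LieAlgebra (F : fieldType) :=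
  {L of isLieAlgebra F L & GRing.Lmodule F L}.

Section Lie.
Variables (F : fieldType) (L : lieAlgType F).

Lemma lieDl (x y z : L) : lie (x + y) z = lie x z + lie y z.
Proof. by have := lie_linearl z 1 x y; rewrite !scale1r. Qed.

Lemma lieDr (x y z : L) : lie z (x + y) = lie z x + lie z y.
Proof. by have := lie_linearr z 1 x y; rewrite !scale1r. Qed.

Lemma lieC (x y : L) : lie x y = - lie y x.
Proof.
apply/eqP; rewrite -addr_eq0; apply/eqP.
by have := liexx (x + y); rewrite lieDl !lieDr !liexx add0r addr0.
Qed.

Definition center : {pred L} := fun z => `[< forall y : L, lie z y = 0 >].

Lemma center_submod_closed : submod_closed center.
Proof.
split=> [|a x y /asboolP hx /asboolP hy]; apply/asboolP => z.
  by apply/(addrI (lie 0 z)); rewrite -lieDl !addr0.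
by rewrite lie_linearl hx hy scaler0 addr0.
Qed.

HB.instance Definition _ :=
  GRing.isSubmodClosed.Build F L center center_submod_closed.

(* [L, L] is the set of commutators, L' its linear span. *)
Definition commutators : set L := [set z | exists x y : L, z = lie x y].

Definition derived_algebra : set L := linspan commutators.

End Lie.

Arguments center {F} L.
Arguments commutators {F} L.
Arguments derived_algebra {F} L.

(* wg_weight G i j is the weight of the edge joining v_i and v_j with i < j;  *)
(* its other values are irrelevant.                                           *)
Record wgraph (F : fieldType) := WGraph {
  wg_order : nat;
  wg_adj : rel 'I_wg_order;
  wg_adj_sym : symmetric wg_adj;
  wg_adj_irr : irreflexive wg_adj;
  wg_weight : 'I_wg_order -> 'I_wg_order -> F
}.

Section Defects.
Variables (F : fieldType) (G : wgraph F).

Local Notation e := (@wg_adj F G).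

Definition signed_weight (p q : 'I_(wg_order G)) : F :=
  if (p < q)%N then wg_weight p q else - wg_weight q p.

Local Notation d := signed_weight.

Definition defect4A : Prop := exists p1 p2 p3 p4 : 'I_(wg_order G),
  [/\ uniq [:: p1; p2; p3; p4],
      [&& e p1 p2, e p1 p3, e p2 p3 & e p3 p4],
      d p1 p3 = 0 /\ d p2 p3 = 0,
      d p1 p2 != 0 & d p3 p4 != 0].

Definition defect4B : Prop := exists p1 p2 p3 p4 : 'I_(wg_order G),
  [/\ uniq [:: p1; p2; p3; p4],
      [&& e p1 p2, e p1 p3, e p1 p4, e p2 p3 & e p3 p4],
      d p1 p3 = 0,
      [&& d p1 p2 != 0, d p1 p4 != 0, d p2 p3 != 0 & d p3 p4 != 0] &
      d p1 p2 * d p3 p4 != - (d p1 p4 * d p2 p3)].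

Definition defect4C : Prop := exists p1 p2 p3 p4 : 'I_(wg_order G),
  [/\ uniq [:: p1; p2; p3; p4],
      [&& e p1 p2, e p1 p3, e p1 p4, e p2 p3, e p2 p4 & e p3 p4],
      [&& d p1 p2 != 0, d p1 p3 != 0, d p1 p4 != 0,
          d p2 p3 != 0, d p2 p4 != 0 & d p3 p4 != 0] &
      d p1 p2 * d p3 p4 + d p1 p4 * d p2 p3 != d p1 p3 * d p2 p4].

Definition defectless : Prop := [/\ ~ defect4A, ~ defect4B & ~ defect4C].

End Defects.

(* d_{i,j} for arbitrary i, j, from the given scalars d_{i,j} with i < j. *)
Definition antisym_ext (F : fieldType) r (d : 'I_r -> 'I_r -> F) (i j : 'I_r)
    : F :=
  if (i < j)%N then d i j else if (j < i)%N then - d j i else 0.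

(* Only the finitely many basis elements u_1, ..., u_r of B2 occurring in the *)
(* expression of x are listed, by pr_u; B2 itself may be infinite.            *)
(* pr_perm is the permuted numbering of the index set I of x: the vertex v_i  *)
(* of the graph stands for pr_u (pr_perm i). The last two fields make it a    *)
(* bijection from 'I_pr_n onto I, whence pr_n = |I|.                          *)
Record presentation (F : fieldType) (L : lieAlgType F) (x : L) := Presentation {
  pr_B1 : set L;
  pr_B2 : set L;
  pr_B1_basis : basis_of_subspace [set z | z \in center L] pr_B1;
  pr_disjoint : pr_B1 `&` pr_B2 = set0;
  pr_basis : basis_of_subspace setT (pr_B1 `|` pr_B2);
  pr_r : nat;
  pr_u : 'I_pr_r -> L;
  pr_u_B2 : forall i, pr_B2 (pr_u i);
  pr_u_inj : injective pr_u;
  pr_d : 'I_pr_r -> 'I_pr_r -> F;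
  pr_sum : x = \sum_(i < pr_r) \sum_(j < pr_r | (i < j)%N)
                 pr_d i j *: lie (pr_u i) (pr_u j);
  pr_n : nat;
  pr_perm : 'I_pr_n -> 'I_pr_r;
  pr_perm_inj : injective pr_perm;
  pr_perm_codom : forall k : 'I_pr_r,
    (k \in codom pr_perm) = [exists j, antisym_ext pr_d k j != 0]
}.

Section PresentationGraph.
Variables (F : fieldType) (L : lieAlgType F) (x : L) (D : presentation x).

Definition pr_vertex (i : 'I_(pr_n D)) : L := pr_u (pr_perm i).

Definition pr_adj : rel 'I_(pr_n D) :=
  fun i j => lie (pr_vertex i) (pr_vertex j) != 0.

Lemma pr_adj_sym : symmetric pr_adj.
Proof. by move=> i j; rewrite /pr_adj lieC oppr_eq0. Qed.

Lemma pr_adj_irr : irreflexive pr_adj.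
Proof. by move=> i; rewrite /pr_adj liexx eqxx. Qed.

Definition pr_graph : wgraph F :=
  WGraph pr_adj_sym pr_adj_irr
    (fun i j => antisym_ext (@pr_d _ _ _ D) (pr_perm i) (pr_perm j)).

End PresentationGraph.

(* Main.v *)
Require Import Defs.
From HB Require Import structures.
From mathcomp Require Import all_boot all_algebra.
From mathcomp Require Import boolp classical_sets functions cardinality.
From mathcomp Require Import ring.

(* A commutator [a,b] <> 0 has the presentation [u1,u2] with u1 = a, u2 = b,  *)
(* whose graph is too small to have a defect. Conversely, as dim(L/Z(L)) = 4, *)
(* x is a combination of the brackets of at most four vectors, and such a     *)
(* combination is a commutator as soon as its Pfaffian                        *)
(* d12 d34 - d13 d24 + d14 d23 vanishes: the bivector is then decomposable.   *)
(* The d_ij on non-edges are arbitrary, as [u_i,u_j] = 0 there. If some       *)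
(* product d_ij d_kl can be given any value in this way, the Pfaffian can be  *)
(* made to vanish; otherwise the absence of defects forces it to vanish.      *)

Set Implicit Arguments.
Unset Strict Implicit.
Unset Printing Implicit Defensive.
Import GRing.Theory.
Local Open Scope ring_scope.

(** The bracket factors through bivectors, and a decomposable bivector [a] ^ [b] is sent to a
    commutator. On four vectors decomposability is the vanishing of the Pfaffian, and
    [commutator_of_pfaffian] writes down the two factors. A nonzero commutator [a,b] conversely
    extends to a basis with [a] and [b] in [pr_B2] ([commutator_presentation]), and a graph on fewer
    than four vertices has no defect.

    For the other direction, vectors of [pr_B2] stay independent modulo the center, so a
    presentation uses at most four of them ([leq_pr_r]); up to three vectors always give a
    commutator ([small_sum_commutator]). With four, the three products in the Pfaffian involve
    disjoint sets of coefficients, so a single adjustable product suffices to cancel it. If none is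
    adjustable, each product comes from two edges or is held at 0 by an edge of weight 0, and
    excluding the three defects gives the relation ([rigid_pfaffian], [defectless_pfaffian]).
    [pr_pfaffian] transfers this to x. *)

(** * Bases by Zorn's lemma, and a dimension bound *)

Section LinearAlgebra.
Local Open Scope classical_set_scope.
Variables (F : fieldType) (V : lmodType F).
Implicit Types (A B W : set V) (v : V).

Lemma linspan_min W B : W 0 ->
    (forall (a : F) (u v : V), W u -> W v -> W (a *: u + v)) ->
  B `<=` W -> linspan B `<=` W.
Proof.
move=> W0 Wlin BW _ [s [c [sB ->]]].
elim: s sB => [|b s IHs] sB; first by rewrite big_nil.
rewrite big_cons; apply: Wlin; first by apply/BW/sB/mem_head.
by apply: IHs => b' sb'; apply: sB; rewrite inE sb' orbT.
Qed.

Lemma sub_linspan B : B `<=` linspan B.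
Proof.
move=> b Bb; exists [:: b], (fun=> 1); split; last by rewrite big_seq1 scale1r.
by move=> b'; rewrite inE => /eqP->.
Qed.

Lemma linspan_uniq B v : linspan B v -> exists (s : seq V) (c : V -> F),
  [/\ uniq s, {in s, forall b, B b} & v = \sum_(b <- s) c b *: b].
Proof.
move=> [s [c [sB ->]]]; exists (undup s), (fun b => c b *+ count_mem b s).
split=> [||]; first exact: undup_uniq.
  by move=> b; rewrite mem_undup; apply: sB.
rewrite -big_undup_iterop_count; apply: eq_bigr => b _.
exact: scalerMnl.
Qed.

Lemma lin_indep_adjoin A v :
  lin_indep A -> ~ linspan A v -> lin_indep (A `|` [set v]).
Proof.
move=> indA Av s c us sA s0.
have [vs|vs] := boolP (v \in s); last first.
  apply: indA us _ s0 => b sb; case: (sA b sb) => // bv.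
  by rewrite -bv sb in vs.
have rem_sub : {in rem v s, forall b, A b}.
  move=> b; rewrite mem_rem_uniq // => /andP[/= bv sb].
  by case: (sA b sb) => // /= bv'; rewrite bv' eqxx in bv.
move: s0; rewrite (perm_big _ (perm_to_rem vs)) big_cons /= => s0.
have cv0 : c v = 0.
  apply/eqP/negP => /negP cv; apply: Av.
  exists (rem v s), (fun b => - (c v)^-1 * c b); split=> //.
  under eq_bigr do rewrite -scalerA.
  rewrite -scaler_sumr -[LHS](scalerK cv).
  by move/eqP: s0; rewrite addr_eq0 => /eqP->; rewrite scalerN scaleNr.
move: s0; rewrite cv0 scale0r add0r => s0 b sb.
have [->//|bv] := eqVneq b v.
by apply: indA (rem_uniq _ us) rem_sub s0 _ _; rewrite mem_rem_uniq // inE bv.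
Qed.

(** A finite list meets finitely many members of the chain, and the largest of them serves for all.
    The case of a list inside [A] covers an empty chain. *)
Lemma lin_indep_bigcup A (C : set (set V)) :
    lin_indep A -> (forall X, C X -> lin_indep (A `|` X)) ->
  total_on C subset -> lin_indep (A `|` \bigcup_(X in C) X).
Proof.
move=> indA indC totC s c us sAC.
suff [sA|[X CX sAX]] : {in s, forall b, A b} \/
    exists2 X, C X & {in s, forall b, (A `|` X) b}.
- exact: indA.
- exact: indC CX _ _ us sAX.
elim: s sAC {us} => [|b s IHs] sAC; first by left.
have {}IHs : {in s, forall b, A b} \/
    exists2 X, C X & {in s, forall b, (A `|` X) b}.
  by apply: IHs => b' sb'; apply: sAC; rewrite inE sb' orbT.
have [Ab|[Y CY Yb]] := sAC b (mem_head _ _).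
  case: IHs => [sA|[X CX sAX]]; [left|right; exists X => //].
    by move=> b'; rewrite inE => /predU1P[->//|]; apply: sA.
  by move=> b'; rewrite inE => /predU1P[->|]; [left|apply: sAX].
right; case: IHs => [sA|[X CX sAX]].
  exists Y => // b'; rewrite inE => /predU1P[->|/sA]; by [right|left].
have [XY|YX] := totC _ _ CX CY.
  exists Y => // b'; rewrite inE => /predU1P[->|/sAX[|/XY]];
    by [right|left|right].
by exists X => // b'; rewrite inE => /predU1P[->|/sAX//]; right; apply: YX.
Qed.

(** Zorn's lemma is applied to the sets [X] to be added to [A], not to the sets containing [A], so
    that the empty chain has the admissible union [set0]. *)
Lemma basis_extension W A : W 0 ->
    (forall (a : F) (u v : V), W u -> W v -> W (a *: u + v)) ->
    A `<=` W -> lin_indep A ->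
  exists2 B, A `<=` B & basis_of_subspace W B.
Proof.
move=> W0 Wlin AW indA.
have [|X [[XW indX] maxX]] :=
    @Zorn_bigcup _ (fun X => X `<=` W /\ lin_indep (A `|` X)).
  move=> C CP totC; split; first by move=> v [X /CP[XW _]] /XW.
  by apply: lin_indep_bigcup => // X /CP[].
have BW : A `|` X `<=` W by move=> v [/AW|/XW].
exists (A `|` X); first by move=> v; left.
split=> //; apply/seteqP; split; first exact: linspan_min.
move=> v Wv; apply: contrapT => nv.
apply: (maxX (X `|` [set v])).
  split=> [|/(_ v (or_intror erefl)) Xv]; first by move=> w; left.
  by apply: nv; apply: sub_linspan; right.
split=> [w [/XW//|->//]|].
by rewrite setUA; apply: lin_indep_adjoin.
Qed.

Lemma has_dim_spanning n : has_dim V n -> exists f : 'I_n -> V,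
  forall v, exists a : 'rV[F]_n, v = \sum_i a 0 i *: f i.
Proof.
move=> [B [[_ spanB] /card_set_bijP[g [g_fun g_inj g_surj]]]].
have /choice[f fP] (i : 'I_n) : exists b, B b /\ g b = i.
  by have [b Bb gb] := g_surj i (ltn_ord i); exists b.
exists f => v.
have : linspan B v by rewrite spanB.
apply: (@linspan_min
  [set v | exists a : 'rV[F]_n, v = \sum_i a 0 i *: f i]) =>
  [|a u w [b ->] [c ->]|b Bb].
- by exists 0; rewrite big1 // => i _; rewrite mxE scale0r.
- exists (a *: b + c); rewrite scaler_sumr -big_split /=.
  by apply: eq_bigr => i _; rewrite !mxE scalerDl scalerA.
have gb : (g b < n)%N by apply: (g_fun b Bb).
have [Bf gf] := fP (Ordinal gb).
exists (delta_mx 0 (Ordinal gb)); rewrite (bigD1 (Ordinal gb)) //= big1.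
  rewrite addr0 mxE !eqxx scale1r; apply/esym.
  by apply: g_inj; rewrite ?inE ?gf.
by move=> j /negPf ji; rewrite mxE ji andbF scale0r.
Qed.

(** The coordinates of the [w i] in a spanning family form an r x n matrix. A row of its left kernel
    is a linear relation among the [w i], so the matrix is row free. *)
Lemma leq_has_dim n r (w : 'I_r -> V) : has_dim V n ->
    (forall c : 'I_r -> F, \sum_i c i *: w i = 0 -> forall i, c i = 0) ->
  (r <= n)%N.
Proof.
move=> /has_dim_spanning[f fP] indw.
have [M wM] : exists M : 'M[F]_(r, n), forall i, w i = \sum_j M i j *: f j.
  have [a aP] := choice (fun i => fP (w i)).
  exists (\matrix_i a i) => i; rewrite [LHS]aP.
  by apply: eq_bigr => j _; rewrite mxE.
suff freeM : row_free M by rewrite -(eqP freeM) rank_leq_col.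
rewrite -kermx_eq0; apply/eqP/row_matrixP => k; rewrite row0.
apply/rowP => i; rewrite [RHS]mxE.
apply: (indw (fun i => row k (kermx M) 0 i)).
under eq_bigr do rewrite wM scaler_sumr.
rewrite exchange_big big1 //= => j _.
under eq_bigr do rewrite scalerA.
rewrite -scaler_suml.
have /rowP/(_ j) : row k (kermx M) *m M = 0 by rewrite -row_mul mulmx_ker row0.
by rewrite !mxE => ->; rewrite scale0r.
Qed.

End LinearAlgebra.

(** * The Pfaffian of a defectless weighting *)

Section DefectlessWeights.
Variables (F : fieldType) (I : eqType) (e : rel I) (w : I -> I -> F).
Hypotheses (e_sym : symmetric e) (w_anti : forall p q, w p q = - w q p).
Hypothesis no_defect4A : forall p1 p2 p3 p4, uniq [:: p1; p2; p3; p4] ->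
  [&& e p1 p2, e p1 p3, e p2 p3 & e p3 p4] ->
  w p1 p3 = 0 -> w p2 p3 = 0 -> w p1 p2 != 0 -> w p3 p4 != 0 -> False.
Hypothesis no_defect4B : forall p1 p2 p3 p4, uniq [:: p1; p2; p3; p4] ->
  [&& e p1 p2, e p1 p3, e p1 p4, e p2 p3 & e p3 p4] ->
  w p1 p3 = 0 ->
  [&& w p1 p2 != 0, w p1 p4 != 0, w p2 p3 != 0 & w p3 p4 != 0] ->
  w p1 p2 * w p3 p4 = - (w p1 p4 * w p2 p3).
Hypothesis no_defect4C : forall p1 p2 p3 p4, uniq [:: p1; p2; p3; p4] ->
  [&& e p1 p2, e p1 p3, e p1 p4, e p2 p3, e p2 p4 & e p3 p4] ->
  [&& w p1 p2 != 0, w p1 p3 != 0, w p1 p4 != 0,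
      w p2 p3 != 0, w p2 p4 != 0 & w p3 p4 != 0] ->
  w p1 p2 * w p3 p4 + w p1 p4 * w p2 p3 = w p1 p3 * w p2 p4.

Hypothesis w_nonedge : forall p q, ~~ e p q -> w p q = 0.

Let w0C p q : w p q = 0 -> w q p = 0.
Proof. by move=> w0; rewrite w_anti w0 oppr0. Qed.

Let wn0C p q : w p q != 0 -> w q p != 0.
Proof. by rewrite (w_anti q) oppr_eq0. Qed.

Let uniq4E (p1 p2 p3 p4 : I) : uniq [:: p1; p2; p3; p4] =
  [&& p1 != p2, p1 != p3, p1 != p4, p2 != p3, p2 != p4 & p3 != p4].
Proof. by rewrite /= !inE !negb_or !andbT -!andbA. Qed.

(** Discharges the side conditions of a lemma or defect used with renamed vertices: they agree with
    the hypotheses up to order and orientation. *)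
Ltac permuted :=
  repeat match goal with H : is_true (uniq _) |- _ => rewrite uniq4E in H end;
  rewrite ?uniq4E;
  repeat match goal with H : is_true (_ && _) |- _ => case/andP: H => * end;
  repeat (apply/andP; split);
  by [|rewrite eq_sym|rewrite e_sym|apply: wn0C|apply: w0C].

(** If both products are nonzero, this is the absence of 4B. If just one is, a zero factor of the
    other and the diagonal p1p3 are two weightless sides of a triangle, which gives a defect 4A. *)
Lemma zero_diagonal p1 p2 p3 p4 : uniq [:: p1; p2; p3; p4] ->
  [&& e p1 p2, e p1 p3, e p1 p4, e p2 p3 & e p3 p4] -> w p1 p3 = 0 ->
  w p1 p2 * w p3 p4 + w p1 p4 * w p2 p3 = 0.
Proof.
move=> u ee w13.
have [|] := eqVneq (w p1 p2 * w p3 p4) 0;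
  have [|] := eqVneq (w p1 p4 * w p2 p3) 0.
- by move=> -> ->; rewrite addr0.
- rewrite mulf_eq0 negb_or => /andP[w14 w23] /eqP; rewrite mulf_eq0.
  case/orP=> /eqP z; first by case: (@no_defect4A p2 p3 p1 p4); permuted.
  by case: (@no_defect4A p1 p4 p3 p2); permuted.
- move=> /eqP; rewrite mulf_eq0 => z.
  rewrite mulf_eq0 negb_or => /andP[w12 w34].
  case/orP: z => /eqP z; first by case: (@no_defect4A p3 p4 p1 p2); permuted.
  by case: (@no_defect4A p1 p2 p3 p4); permuted.
rewrite !mulf_eq0 !negb_or => /andP[w14 w23] /andP[w12 w34].
by rewrite (@no_defect4B p1 p2 p3 p4) ?addNr //; permuted.
Qed.

(* Off the null pairs and the pairs of edges, the product w p q * w r s can   *)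
(* be given any value by changing w on non-edges (rigid_or_free).             *)
Let null_pair p q r s := [/\ e p q || e r s, w p q = 0 & w r s = 0].

Let rigid p q r s := e p q && e r s \/ null_pair p q r s.

(** The null pairs supply two weightless edges with a common vertex. One of p1p2, p3p4 closes them
    to a triangle and the other hangs at that vertex: a defect 4A if both weights are nonzero. *)
Lemma two_null_pairs p1 p2 p3 p4 : uniq [:: p1; p2; p3; p4] ->
  e p1 p2 && e p3 p4 -> null_pair p1 p3 p2 p4 -> null_pair p1 p4 p2 p3 ->
  w p1 p2 * w p3 p4 = 0.
Proof.
move=> u ee [e13 w13 w24] [e14 w14 w23].
have [->|w12] := eqVneq (w p1 p2) 0; first by rewrite mul0r.
have [->|w34] := eqVneq (w p3 p4) 0; first by rewrite mulr0.
case/orP: e13 => e13; case/orP: e14 => e14.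
- by case: (@no_defect4A p3 p4 p1 p2); permuted.
- by case: (@no_defect4A p1 p2 p3 p4); permuted.
- by case: (@no_defect4A p1 p2 p4 p3); permuted.
- by case: (@no_defect4A p3 p4 p2 p1); permuted.
Qed.

(** If the four sides are edges, an edge among the diagonals puts [zero_diagonal] in force. If one
    pair of opposite sides is null, [two_null_pairs] kills the other product. *)
Lemma null_diagonals p1 p2 p3 p4 : uniq [:: p1; p2; p3; p4] ->
  null_pair p1 p3 p2 p4 -> rigid p1 p2 p3 p4 -> rigid p1 p4 p2 p3 ->
  w p1 p2 * w p3 p4 + w p1 p4 * w p2 p3 = 0.
Proof.
move=> u nz [ee12|nz12] [ee14|nz14].
- case: nz => /orP[e13|e24] w13 w24; first by apply: zero_diagonal; permuted.
  have := @zero_diagonal p2 p1 p4 p3.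
  rewrite (w_anti p2 p1) (w_anti p4 p3) mulrNN.
  by rewrite (mulrC (w p2 p3)); apply; permuted.
- by case: (nz14) => _ -> _; rewrite mul0r addr0 two_null_pairs.
- case: (nz12) => _ -> _; rewrite mul0r add0r (w_anti p2) mulrN.
  rewrite (@two_null_pairs p1 p4 p3 p2) ?oppr0 //; first by permuted.
  + by case/andP: ee14 => -> /=; rewrite e_sym.
  + by case: nz => e13 w13 w24; split=> //; [rewrite (e_sym p4)|apply: w0C].
  by case: nz12 => e12 w12 w34; split=> //; [rewrite (e_sym p4)|apply: w0C].
by case: nz12 nz14 => _ -> _ [_ -> _]; rewrite !mul0r addr0.
Qed.

(** A null pair can be renamed to be the diagonals, which reduces to [null_diagonals]; without one
    the graph is complete on the four vertices. *)
Lemma rigid_pfaffian p1 p2 p3 p4 : uniq [:: p1; p2; p3; p4] ->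
    rigid p1 p2 p3 p4 -> rigid p1 p3 p2 p4 -> rigid p1 p4 p2 p3 ->
  w p1 p2 * w p3 p4 + w p1 p4 * w p2 p3 = w p1 p3 * w p2 p4.
Proof.
move=> u r12 r13 r14.
have sw p q r s : rigid p q r s -> rigid p q s r.
  case=> [ee|[en wpq wrs]]; [left|right]; rewrite /null_pair (e_sym s) //.
  by split=> //; apply: w0C.
have [ee12|nz12] := (r12); last first.
  have := @null_diagonals p1 p3 p2 p4; rewrite (w_anti p3 p2) mulrN.
  case: (nz12) => _ -> _ H; rewrite mul0r add0r; apply/esym/subr0_eq/H => //.
    by permuted.
  exact: sw.
have [ee13|nz13] := (r13); last first.
  by rewrite null_diagonals //; case: nz13 => _ -> _; rewrite mul0r.
have [ee14|nz14] := (r14); last first.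
  have := @null_diagonals p1 p2 p4 p3; rewrite (w_anti p4 p3) mulrN.
  case: (nz14) => _ -> _ H; rewrite mul0r addr0.
  apply/esym/subr0_eq; rewrite addrC; apply: H => //; last exact: sw.
  by permuted.
(* All six pairs are now edges. An edge of weight 0 is made the diagonal of [zero_diagonal] by
   renaming; with no such edge, the absence of 4C applies. *)
have [w13|w13] := eqVneq (w p1 p3) 0.
  by rewrite zero_diagonal ?w13 ?mul0r //; permuted.
have [w24|w24] := eqVneq (w p2 p4) 0.
  have := @zero_diagonal p2 p1 p4 p3.
  rewrite (w_anti p2 p1) (w_anti p4 p3) mulrNN.
  by rewrite (mulrC (w p2 p3)) w24 mulr0; apply; permuted.
have [w12|w12] := eqVneq (w p1 p2) 0.
  have := @zero_diagonal p1 p3 p2 p4.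
  rewrite w12 (w_anti p3 p2) mul0r add0r mulrN.
  by move=> H; apply/esym/subr0_eq/H; permuted.
have [w34|w34] := eqVneq (w p3 p4) 0.
  have := @zero_diagonal p3 p1 p4 p2.
  rewrite w34 (w_anti p3 p1) (w_anti p4 p2).
  rewrite mulrNN (w_anti p3 p2) mulNr mulr0 add0r (mulrC (w p2 p3)).
  by move=> H; apply/esym/subr0_eq/H; permuted.
have [w14|w14] := eqVneq (w p1 p4) 0.
  have := @zero_diagonal p1 p2 p4 p3.
  rewrite w14 (w_anti p4 p3) mul0r addr0 mulrN.
  by rewrite addrC => H; apply/esym/subr0_eq/H; permuted.
have [w23|w23] := eqVneq (w p2 p3) 0.
  have := @zero_diagonal p2 p1 p3 p4.
  rewrite w23 (w_anti p2 p1) mulr0 addr0 mulNr.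
  by rewrite addrC (mulrC (w p2 p4)) => H; apply/esym/subr0_eq/H; permuted.
by apply: no_defect4C; permuted.
Qed.

(** A non-edge opposite an edge of nonzero weight is solved for by division; two non-edges take the
    values [t] and 1. *)
Lemma rigid_or_free p q r s : rigid p q r s \/
  forall t, exists a b,
    [/\ e p q -> a = w p q, e r s -> b = w r s & a * b = t].
Proof.
rewrite /rigid; case: (boolP (e p q)) (boolP (e r s)) => [epq|npq] [ers|nrs].
- by left; left.
- have [w0|w0] := eqVneq (w p q) 0.
    by left; right; split; [rewrite epq| |apply: w_nonedge].
  by right=> t; exists (w p q), (t / w p q); split=> //; rewrite mulrC divfK.
- have [w0|w0] := eqVneq (w r s) 0.
    by left; right; split; [rewrite ers orbT|apply: w_nonedge|].
  by right=> t; exists (t / w r s), (w r s); split=> //; rewrite divfK.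
by right=> t; exists t, 1; split=> //; rewrite mulr1.
Qed.

(** Each of the three products has its own two coefficients, so a free one is set to balance the
    other two without disturbing them. *)
Lemma defectless_pfaffian p1 p2 p3 p4 : uniq [:: p1; p2; p3; p4] ->
  exists a12 a13 a14 a23 a24 a34 : F,
    [/\ [/\ e p1 p2 -> a12 = w p1 p2, e p1 p3 -> a13 = w p1 p3 &
            e p1 p4 -> a14 = w p1 p4],
        [/\ e p2 p3 -> a23 = w p2 p3, e p2 p4 -> a24 = w p2 p4 &
            e p3 p4 -> a34 = w p3 p4] &
        a12 * a34 + a14 * a23 = a13 * a24].
Proof.
move=> u.
have [r12|/(_ (w p1 p3 * w p2 p4 - w p1 p4 * w p2 p3))[a12 [a34 [? ? E]]]] :=
    rigid_or_free p1 p2 p3 p4; last first.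
  exists a12, (w p1 p3), (w p1 p4), (w p2 p3), (w p2 p4), a34.
  by split=> //; rewrite E subrK.
have [r13|/(_ (w p1 p2 * w p3 p4 + w p1 p4 * w p2 p3))[a13 [a24 [? ? E]]]] :=
    rigid_or_free p1 p3 p2 p4; last first.
  by exists (w p1 p2), a13, (w p1 p4), (w p2 p3), a24, (w p3 p4).
have [r14|/(_ (w p1 p3 * w p2 p4 - w p1 p2 * w p3 p4))[a14 [a23 [? ? E]]]] :=
    rigid_or_free p1 p4 p2 p3; last first.
  exists (w p1 p2), (w p1 p3), a14, a23, (w p2 p4), (w p3 p4).
  by split=> //; rewrite E addrC subrK.
exists (w p1 p2), (w p1 p3), (w p1 p4), (w p2 p3), (w p2 p4), (w p3 p4).
by split=> //; apply: rigid_pfaffian.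
Qed.

End DefectlessWeights.

HB.instance Definition _ (F : fieldType) (V : lmodType F)
    (W : submodClosed V) :=
  GRing.isLinear.Build F V (quotient_space W) *:%R (@quotient_proj F V W)
    (@quotient_proj_linear F V W).

(** * Decomposable bivectors and commutators *)

Section Brackets.
Variables (F : fieldType) (L : lieAlgType F).
Implicit Types (u x y : L) (a : F).

HB.instance Definition _ x := GRing.isLinear.Build F L L *:%R (lie x)
  (lie_linearr x).

Lemma lieZl a x y : lie (a *: x) y = a *: lie x y.
Proof. by rewrite lieC linearZ /= -scalerN -lieC. Qed.

(** The image under the bracket of the bivector with coordinates [aij]. *)
Definition bracket_sum u1 u2 u3 u4 a12 a13 a14 a23 a24 a34 : L :=
  a12 *: lie u1 u2 + a13 *: lie u1 u3 + a14 *: lie u1 u4 +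
  a23 *: lie u2 u3 + a24 *: lie u2 u4 + a34 *: lie u3 u4.

Let scaleN_lieC a x y : - a *: lie y x = a *: lie x y.
Proof. by rewrite (lieC y) scaleNr scalerN opprK. Qed.

Lemma bracket_sum_swap12 u1 u2 u3 u4 a12 a13 a14 a23 a24 a34 :
  bracket_sum u2 u1 u3 u4 (- a12) a23 a24 a13 a14 a34 =
  bracket_sum u1 u2 u3 u4 a12 a13 a14 a23 a24 a34.
Proof. by rewrite /bracket_sum scaleN_lieC [LHS](ACl (1*4*5*2*3*6)). Qed.

Lemma bracket_sum_swap23 u1 u2 u3 u4 a12 a13 a14 a23 a24 a34 :
  bracket_sum u1 u3 u2 u4 a13 a12 a14 (- a23) a34 a24 =
  bracket_sum u1 u2 u3 u4 a12 a13 a14 a23 a24 a34.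
Proof. by rewrite /bracket_sum scaleN_lieC [LHS](ACl (2*1*3*4*6*5)). Qed.

Lemma bracket_sum_swap34 u1 u2 u3 u4 a12 a13 a14 a23 a24 a34 :
  bracket_sum u1 u2 u4 u3 a12 a14 a13 a24 a23 (- a34) =
  bracket_sum u1 u2 u3 u4 a12 a13 a14 a23 a24 a34.
Proof. by rewrite /bracket_sum scaleN_lieC [LHS](ACl (1*3*2*5*4*6)). Qed.

Lemma commutator_of_pfaffian12 u1 u2 u3 u4 a12 a13 a14 a23 a24 a34 :
  a12 != 0 -> a12 * a34 + a14 * a23 = a13 * a24 ->
  commutators L (bracket_sum u1 u2 u3 u4 a12 a13 a14 a23 a24 a34).
Proof.
move=> a12n0 pf.
(* These factors reproduce every coefficient but that of [u3,u4], which comes out as (a13 a24 - a14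
   a23) / a12; this is [a34] by the Pfaffian relation. *)
exists (u1 - (a23 / a12) *: u3 - (a24 / a12) *: u4),
       (a12 *: u2 + a13 *: u3 + a14 *: u4).
rewrite -!scaleNr !lieDl !lieZl !linearD !linearZ /= !liexx !scaler0.
rewrite !scalerA !addr0 !addrA !mulrN !scaleN_lieC.
rewrite !(mulrCA a12) mulfV // !mulr1.
rewrite -[X in X *: lie u4 u3]opprK scaleN_lieC.
rewrite [RHS](ACl (1*2*3*4*6*(5*7))) /= -scalerDl; congr (_ + _ *: _).
apply: (mulIf a12n0); rewrite !mulrA -mulNr -mulrDl divfK //.
by rewrite addrC -pf addrK mulrC.
Qed.

(** Transposing two vectors only changes the sign of the Pfaffian, so any nonzero coefficient can be
    moved to position 12. *)
Lemma commutator_of_pfaffian u1 u2 u3 u4 a12 a13 a14 a23 a24 a34 :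
  a12 * a34 + a14 * a23 = a13 * a24 ->
  commutators L (bracket_sum u1 u2 u3 u4 a12 a13 a14 a23 a24 a34).
Proof.
have H13 v1 v2 v3 v4 b12 b13 b14 b23 b24 b34 :
    b13 != 0 -> b12 * b34 + b14 * b23 = b13 * b24 ->
    commutators L (bracket_sum v1 v2 v3 v4 b12 b13 b14 b23 b24 b34).
  move=> nz pf; rewrite -bracket_sum_swap23.
  by apply: commutator_of_pfaffian12 => //; rewrite mulrN -pf addrK.
have H14 v1 v2 v3 v4 b12 b13 b14 b23 b24 b34 :
    b14 != 0 -> b12 * b34 + b14 * b23 = b13 * b24 ->
    commutators L (bracket_sum v1 v2 v3 v4 b12 b13 b14 b23 b24 b34).
  move=> nz pf; rewrite -bracket_sum_swap34.
  by apply: H13 => //; rewrite mulrN -pf addrC addrAC subrr add0r.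
move=> pf.
have [a12_0|] := eqVneq a12 0; last first.
  by move=> nz; apply: commutator_of_pfaffian12.
have [a13_0|] := eqVneq a13 0; last by move=> nz; apply: H13.
have [a14_0|] := eqVneq a14 0; last by move=> nz; apply: H14.
have [a23_0|nz] := eqVneq a23 0; last first.
  rewrite -bracket_sum_swap12; apply: H13 => //.
  by rewrite a12_0 a13_0 a14_0; ring.
have [a24_0|nz] := eqVneq a24 0; last first.
  rewrite -bracket_sum_swap12; apply: H14 => //.
  by rewrite a12_0 a13_0 a14_0 a23_0; ring.
(* The two transpositions bring [a34] to position 14. *)
rewrite -bracket_sum_swap23 -bracket_sum_swap12.
have [a34_0|nz] := eqVneq a34 0; last first.
  by apply: H14 => //; rewrite a12_0 a13_0 a14_0 a23_0 a24_0; ring.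
exists 0, 0; rewrite liexx /bracket_sum a12_0 a13_0 a14_0 a23_0 a24_0 a34_0.
by rewrite !oppr0 !scale0r !addr0.
Qed.

End Brackets.

(** * Presentations, their graphs, and the equivalence *)

Lemma defectless_small (F : fieldType) (G : wgraph F) :
  (wg_order G < 4)%N -> defectless G.
Proof.
have no4 (p1 p2 p3 p4 : 'I_(wg_order G)) : uniq [:: p1; p2; p3; p4] ->
    ~ (wg_order G < 4)%N.
  move=> /card_uniqP/= c4 lt4; have := max_card [in [:: p1; p2; p3; p4]].
  by rewrite c4 card_ord leqNgt lt4.
by move=> lt4; split=> -[p1 [p2 [p3 [p4 [/no4]]]]] /(_ lt4).
Qed.

Lemma antisym_extN (F : fieldType) r (d : 'I_r -> 'I_r -> F) i j :
  antisym_ext d i j = - antisym_ext d j i.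
Proof. by rewrite /antisym_ext; case: ltngtP; rewrite ?opprK ?oppr0. Qed.

Section Presentations.
Local Open Scope classical_set_scope.
Variables (F : fieldType) (L : lieAlgType F).
Implicit Types (x a b : L).

Lemma center_lin (k : F) (u v : L) : [set z | z \in center L] u ->
  [set z | z \in center L] v -> [set z | z \in center L] (k *: u + v).
Proof. by move=> /= uZ vZ; rewrite rpredD ?rpredZ. Qed.

Lemma center_basis :
  exists B1 : set L, basis_of_subspace [set z | z \in center L] B1.
Proof.
have [||||B1 _ B1_basis] := @basis_extension _ L [set z | z \in center L] set0.
- exact: rpred0.
- exact: center_lin.
- by [].
- by move=> [|b s] c _ s0 _ //; case: (s0 b (mem_head _ _)).
by exists B1.
Qed.

(** [a] is not central, and [b] lies outside the span of [B1] and [a] because that span centralizes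
    [a]. So both can be adjoined to [B1]. *)
Lemma basis_through_noncommuting (B1 : set L) a b :
    basis_of_subspace [set z | z \in center L] B1 -> lie a b != 0 ->
  exists B2 : set L, [/\ B1 `&` B2 = set0,
    basis_of_subspace setT (B1 `|` B2), B2 a & B2 b].
Proof.
move=> [indB1 spanB1] ab.
have aB1 : ~ linspan B1 a.
  by rewrite spanB1 => /asboolP/(_ b)/eqP; rewrite (negPf ab).
have centralizer_a : linspan (B1 `|` [set a]) `<=` [set v | lie a v = 0].
  apply: linspan_min => [|k u v /= au av|v [B1v|->]] /=.
  - exact: raddf0.
  - by rewrite lie_linearr au av scaler0 addr0.
  - have : linspan B1 v by apply: sub_linspan.
    by rewrite spanB1 lieC => /asboolP/(_ a)->; rewrite oppr0.
  exact: liexx.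
have bB1 : ~ linspan (B1 `|` [set a]) b.
  by move=> /centralizer_a/eqP; rewrite (negPf ab).
have [||||B AB [indB spanB]] :=
  @basis_extension _ L setT (B1 `|` [set a] `|` [set b]).
- by [].
- by [].
- by [].
- by do 2! apply: lin_indep_adjoin => //.
exists (B `\` B1); split.
- by rewrite setDIK.
- rewrite setDUK // => v B1v; apply: AB; left; by left.
- split; first by apply: AB; left; right.
  by move=> B1a; apply: aB1; apply: sub_linspan.
split; first by apply: AB; right.
by move=> B1b; apply: bB1; apply: sub_linspan; left.
Qed.

Lemma commutator_presentation x :
  commutators L x -> exists D : presentation x, (pr_n D < 4)%N.
Proof.
move=> [a [b xab]]; have [B1 B1_basis] := center_basis.
have [x0|xn0] := eqVneq x 0.
  have [||||B AB [indB spanB]] := @basis_extension _ L setT B1.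
  - by [].
  - by [].
  - by [].
  - by case: B1_basis.
  have disj : B1 `&` (B `\` B1) = set0 by rewrite setDIK.
  have basis : basis_of_subspace setT (B1 `|` (B `\` B1)) by rewrite setDUK.
  pose u (i : 'I_0) : L := 0.
  have uB i : (B `\` B1) (u i) by case: i.
  have u_inj : injective u by case.
  pose d (i j : 'I_0) : F := 0.
  have xsum :
      x = \sum_(i < 0) \sum_(j < 0 | (i < j)%N) d i j *: lie (u i) (u j).
    by rewrite big_ord0.
  have codom0 (k : 'I_0) :
      (k \in codom (@id 'I_0)) = [exists j, antisym_ext d k j != 0] by case: k.
  by exists (Presentation B1_basis disj basis uB u_inj xsum (@inj_id _) codom0).
have [|B2 [disj basis B2a B2b]] := @basis_through_noncommuting B1 a b B1_basis.
  by rewrite -xab.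
pose u (i : 'I_2) : L := if val i is 0 then a else b.
have uB i : B2 (u i) by rewrite /u; case: (val i).
have ab : a <> b by move=> ab; move: xn0; rewrite xab ab liexx eqxx.
have u_inj : injective u.
  by move=> [[|[|//]] ?] [[|[|//]] ?] //= E; apply: val_inj => //; case: ab.
(* Only the value at (0,1) enters the sum; by antisymmetry it puts both indices in the index set. *)
pose d (i j : 'I_2) : F := 1.
have xsum : x = \sum_(i < 2) \sum_(j < 2 | (i < j)%N) d i j *: lie (u i) (u j).
  under eq_bigr do rewrite big_mkcond.
  rewrite !big_ord_recl !big_ord0 /= !addr0 add0r scale1r.
  exact: xab.
have codom2 (k : 'I_2) :
    (k \in codom (@id 'I_2)) = [exists j, antisym_ext d k j != 0].
  transitivity true; first by apply/codomP; exists k.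
  apply/esym/existsP; case: k => [[|[|k]] //= ltk].
    by exists (lift ord0 ord0); rewrite /antisym_ext /= oner_eq0.
  by exists ord0; rewrite /antisym_ext /= oppr_eq0 oner_eq0.
by exists (Presentation B1_basis disj basis uB u_inj xsum (@inj_id _) codom2).
Qed.

(** A relation among the [pr_u] modulo the center equates a combination of them with one of [pr_B1],
    and the joint basis makes it trivial. *)
Lemma leq_pr_r n x (D : presentation x) :
  has_dim (quotient_space (center L)) n -> (pr_r D <= n)%N.
Proof.
pose u := @pr_u _ _ _ D.
move=> /(@leq_has_dim _ _ _ _ (fun i => quotient_proj (center L) (u i))); apply.
move=> c c0 i.
have [indB _] := pr_basis D.
have disj v : pr_B1 D v -> pr_B2 D v -> False.
  by move=> v1 v2; suff: (pr_B1 D `&` pr_B2 D) v by rewrite pr_disjoint.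
have : linspan (pr_B1 D) (\sum_j c j *: u j).
  rewrite (pr_B1_basis D).2 /= -[X in X \in _]subr0 -quotient_proj_eq.
  rewrite linear0 linear_sum -[X in _ == X]c0.
  by apply/eqP/eq_bigr => j _; rewrite linearZ.
move=> /linspan_uniq[s [k [us sB1 cE]]].
have us_disj j : u j \notin s.
  by apply/negP => /sB1 /disj; apply; apply: pr_u_B2.
(* Coefficients are functions of vectors: -k on the central part and, since [pr_u] is injective,
   [c j] at [u j]. *)
pose h v := if v \in s then - k v else \sum_(j | u j == v) c j.
have hu j : h (u j) = c j.
  rewrite /h (negPf (us_disj j)) (big_pred1 j) // => j'.
  by rewrite /= inj_eq //; apply: pr_u_inj.
rewrite -hu; apply: (indB ([seq u j | j : 'I_(pr_r D)] ++ s)).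
- rewrite cat_uniq us map_inj_uniq ?enum_uniq ?andbT; last exact: pr_u_inj.
  apply/hasPn => v vs; apply/negP => /codomP[j vj].
  by rewrite vj (negPf (us_disj j)) in vs.
- move=> v; rewrite mem_cat => /orP[/codomP[j ->]|/sB1]; last by left.
  by right; apply: pr_u_B2.
- rewrite big_cat big_image /=; under eq_bigr do rewrite hu.
  rewrite cE -big_split big1_seq //= => v vs.
  by rewrite /h vs scaleNr subrr.
by rewrite mem_cat codom_f.
Qed.

Lemma pr_pfaffian x (D : presentation x) (p1 p2 p3 p4 : 'I_(pr_r D)) :
    defectless (pr_graph D) -> uniq [:: p1; p2; p3; p4] ->
  let u := @pr_u _ _ _ D in let w := antisym_ext (@pr_d _ _ _ D) in
  exists a12 a13 a14 a23 a24 a34 : F,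
    a12 * a34 + a14 * a23 = a13 * a24 /\
    bracket_sum (u p1) (u p2) (u p3) (u p4)
      (w p1 p2) (w p1 p3) (w p1 p4) (w p2 p3) (w p2 p4) (w p3 p4) =
    bracket_sum (u p1) (u p2) (u p3) (u p4) a12 a13 a14 a23 a24 a34.
Proof.
move=> [no4A no4B no4C] uniqp u w.
have wN p q : w p q = - w q p by exact: antisym_extN.
have [|not_codom] :=
  boolP (all [in codom (@pr_perm _ _ _ D)] [:: p1; p2; p3; p4]);
  last first.
  exists (w p1 p2), (w p1 p3), (w p1 p4), (w p2 p3), (w p2 p4), (w p3 p4).
  split=> //.
  have w0 p q : p \notin codom (@pr_perm _ _ _ D) -> w p q = 0.
    by rewrite pr_perm_codom => /existsPn/(_ q)/negPn/eqP.
  (* Every product in the Pfaffian involves all four indices, so one index of zero weights makes all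
     three vanish. *)
  move: not_codom; rewrite /= andbT !negb_and.
  case/or4P => /w0 wp0.
  - by rewrite !wp0 !mul0r addr0.
  - by rewrite (wN p1) !wp0 !(oppr0, mul0r, mulr0) addr0.
  - by rewrite (wN p1 p3) (wN p2 p3) !wp0 !(oppr0, mul0r, mulr0) addr0.
  by rewrite (wN p1 p4) (wN p2 p4) (wN p3) !wp0 !(oppr0, mul0r, mulr0) addr0.
rewrite /= andbT.
case/and4P=> /codomP[q1 p1E] /codomP[q2 p2E] /codomP[q3 p3E] /codomP[q4 p4E].
move: uniqp; rewrite {}p1E {}p2E {}p3E {}p4E => uniqp {p1 p2 p3 p4}.
have uniqq : uniq [:: q1; q2; q3; q4].
  by rewrite -(map_inj_uniq (@pr_perm_inj _ _ _ D)).
(* The scalars on non-edges may be nonzero; they are reset to 0 as [defectless_pfaffian]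
   requires. *)
pose w' p q := if pr_adj p q then w (pr_perm p) (pr_perm q) else 0.
have signedE p q :
    @signed_weight F (pr_graph D) p q = w (pr_perm p) (pr_perm q).
  by rewrite /signed_weight /=; case: ifP => // _; rewrite -wN.
have [||||||a12 [a13 [a14 [a23 [a24 [a34]]]]]] :=
    @defectless_pfaffian F _ (@pr_adj _ _ _ D) w' _ _ _ _ _ _ q1 q2 q3 q4 uniqq.
- exact: pr_adj_sym.
- move=> p q; rewrite /w' pr_adj_sym (wN (pr_perm p)).
  by case: ifP; rewrite ?oppr0.
- move=> p1 p2 p3 p4 up ee; move: (ee) => /and4P[e12 e13 e23 e34].
  rewrite /w' e12 e13 e23 e34 => w13 w23 w12 w34; apply: no4A.
  by exists p1, p2, p3, p4; rewrite !signedE; split.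
- move=> p1 p2 p3 p4 up ee; move: (ee) => /and5P[e12 e13 e14 e23 e34].
  rewrite /w' e12 e13 e14 e23 e34 => w13 wn0; apply/eqP/negPn/negP => pf.
  by apply: no4B; exists p1, p2, p3, p4; rewrite !signedE; split.
- move=> p1 p2 p3 p4 up ee.
  move: (ee) => /and5P[e12 e13 e14 e23 /andP[e24 e34]].
  rewrite /w' e12 e13 e14 e23 e24 e34 => wn0; apply/eqP/negPn/negP => pf.
  by apply: no4C; exists p1, p2, p3, p4; rewrite !signedE; split.
- by move=> p q /negPf; rewrite /w' => ->.
move=> [[E12 E13 E14] [E23 E24 E34] pf].
exists a12, a13, a14, a23, a24, a34; split=> //.
(* Off the edges the bracket is 0, so replacing the coefficient there does not change the sum. *)
have weightE p q (k : F) : (pr_adj p q -> k = w' p q) ->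
    w (pr_perm p) (pr_perm q) *: lie (u (pr_perm p)) (u (pr_perm q)) =
    k *: lie (u (pr_perm p)) (u (pr_perm q)).
  rewrite /w'; have [_ /(_ isT)->//|] := boolP (pr_adj p q).
  by rewrite negbK => /eqP; rewrite /pr_vertex -/u => -> _; rewrite !scaler0.
by rewrite /bracket_sum (weightE _ _ _ E12) (weightE _ _ _ E13)
  (weightE _ _ _ E14) (weightE _ _ _ E23) (weightE _ _ _ E24)
  (weightE _ _ _ E34).
Qed.

(** Bivectors on three vectors are decomposable: with a zero fourth vector and zero coefficients for
    it, the Pfaffian vanishes. *)
Lemma small_sum_commutator r (u : 'I_r -> L) (d : 'I_r -> 'I_r -> F) :
  (r < 4)%N ->
  commutators L
    (\sum_(i < r) \sum_(j < r | (i < j)%N) d i j *: lie (u i) (u j)).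
Proof.
under eq_bigr do rewrite big_mkcond.
case: r u d => [|[|[|[|//]]]] u d _;
  rewrite !(big_ord_recl, big_ord0) /= ?(addr0, add0r).
- by exists 0, 0; rewrite liexx.
- by exists 0, 0; rewrite liexx.
- by eexists; eexists; rewrite -lieZl.
set u0 := u _; set u1 := u _; set u2 := u _; set d01 := d _ _; set d02 := d _ _.
set d12 := d _ _.
have := @commutator_of_pfaffian _ _ u0 u1 u2 0 d01 d02 0 d12 0 0.
by rewrite /bracket_sum !(mulr0, mul0r, scale0r, addr0); apply.
Qed.

Lemma defectless_commutator x (D : presentation x) :
  has_dim (quotient_space (center L)) 4 -> defectless (pr_graph D) ->
  commutators L x.
Proof.
move=> /(leq_pr_r D) le4 /pr_pfaffian; rewrite [X in commutators _ X](pr_sum D).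
move: le4; rewrite leq_eqVlt => /orP[/eqP r4|lt4 _]; last first.
  exact: small_sum_commutator.
(* The types of these families depend on [pr_r D], so they are generalized before it is replaced by
   4. *)
move: (@pr_u _ _ _ D) (@pr_d _ _ _ D); rewrite r4 => u d pf.
under eq_bigr do rewrite big_mkcond.
rewrite !(big_ord_recl, big_ord0) /= ?(addr0, add0r).
have [|a12 [a13 [a14 [a23 [a24 [a34 [pfa]]]]]]] := pf ord0 (lift ord0 ord0)
  (lift ord0 (lift ord0 ord0)) (lift ord0 (lift ord0 (lift ord0 ord0))) => //.
rewrite /antisym_ext /= /bracket_sum !addrA => ->.
exact: commutator_of_pfaffian.
Qed.

End Presentations.

Theorem corollary4p8 (F : fieldType) (L : lieAlgType F)
    (L_countable_dim : has_countable_dim L)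
    (L_mod_center_dim : has_dim (quotient_space (center L)) 4)
    (x : L) (x_derived : derived_algebra L x) :
  commutators L x <->
  exists D : presentation x, defectless (pr_graph D).
Proof.
split=> [/commutator_presentation[D lt4]|[D]].
  by exists D; apply: defectless_small.
exact: defectless_commutator.
Qed.
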